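(* Let $\partial\in\mathbb{Z}^{n\times n}$ have rank $r$ and satisfy $\partial^t=\partial$ or $\partial^t=-\partial$. Then all nonzero $r\times r$ principal minors $\det(\partial_{I,I})$, $|I|=r$, have the same sign, so that for some fixed sign $\epsilon\in\{+1,-1\}$, $$\operatorname{pdet}(\partial)=\epsilon\sum_{I\in\mathrm{RowB}(\partial)}|\operatorname{coker}(\partial_{I,I})|,\qquad \operatorname{pdet}(X\partial)=\epsilon\sum_{I\in\mathrm{RowB}(\partial)}\mathbf{x}^I\,|\operatorname{coker}(\partial_{I,I})|,$$ where $\mathbf{x}=(x_1,\dots,x_n)$ are indeterminates, $X=\operatorname{diag}(\mathbf{x})$ and $\mathbf{x}^I=\prod_{i\in I}x_i$.
   Context: For a square matrix $L$ of size $n$ over an integral domain, of rank $s$ (over the fraction field), $\operatorname{pdet}(L):=\sum_{I\subseteq\{1,\dots,n\},|I|=s}\det(L_{I,I})$, where $L_{I,J}$ denotes the submatrix with rows $I$ and columns $J$. A subset $I$ of row indices is a row basis ($I\in\mathrm{RowB}(\partial)$) if the rows indexed by $I$ form a $\mathbb{Q}$-basis of the row space of $\partial$. For $I\in\mathrm{RowB}(\partial)$, $\partial_{I,I}$ is viewed as a map $\mathbb{Z}^I\to\mathbb{Z}^I$ and $\operatorname{coker}$ denotes its cokernel. *)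

(* Defs.v *)
From HB Require Import structures.
From mathcomp Require Import all_boot all_order all_algebra finmap.
From mathcomp Require Import boolp classical_sets cardinality.
From mathcomp Require Import mpoly.

Set Implicit Arguments.
Unset Strict Implicit.
Unset Printing Implicit Defensive.

Import GRing.Theory.
Local Open Scope ring_scope.

Definition submx_set (R : Type) (m n : nat) (L : 'M[R]_(m, n))
    (I : {set 'I_m}) (J : {set 'I_n}) : 'M[R]_(#|I|, #|J|) :=
  mxsub (fun i : 'I_#|I| => enum_val i) (fun j : 'I_#|J| => enum_val j) L.

Definition frac_rank (R : idomainType) (m n : nat) (L : 'M[R]_(m, n)) : nat :=
  \rank (map_mx (@tofrac R) L).

Definition pdet (R : idomainType) (n : nat) (L : 'M[R]_n) : R :=
  \sum_(I : {set 'I_n} | #|I| == frac_rank L) \det (submx_set L I I).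

(* [row_free] is linear independence over rat, and the equality in %MS says
   that the selected rows span the whole row space. *)
Definition RowB (m n : nat) (d : 'M[int]_(m, n)) : {set {set 'I_m}} :=
  [set I : {set 'I_m} |
    let dQ : 'M[rat]_(m, n) := map_mx intr d in
    let dI := rowsub (fun i : 'I_#|I| => enum_val i) dQ in
    row_free dI && (dI == dQ)%MS].

Section Cokernel.
Variables (m n : nat) (M : 'M[int]_(m, n)).

Definition im_mx : {pred 'cV[int]_m} :=
  fun v => `[< exists u : 'cV[int]_n, v = M *m u >].

Lemma im_mx_zmod_closed : zmod_closed im_mx.
Proof.
split=> [|_ _ /asboolP[u ->] /asboolP[v ->]]; apply/asboolP.
  by exists 0; rewrite mulmx0.
by exists (u - v); rewrite mulmxBr.
Qed.

HB.instance Definition _ :=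
  GRing.isZmodClosed.Build 'cV[int]_m im_mx im_mx_zmod_closed.

Definition coker : zmodType := Quotient.quot im_mx.

(* [fset_set] is empty on infinite sets, so this is the cardinality of the
   cokernel only when the cokernel is finite. *)
Definition card_coker : nat := #|` fset_set [set: coker] |%fset.

End Cokernel.

(* Main.v *)
(* Over the rationals write d = U V with inner size r = rank d, so that
   det d_{I,J} = det U_I * det V_J when |I| = |J| = r.  Hence
   det d_{I,I} * det d_{J,J} = det d_{I,J} * det d_{J,I}
                             = (+-1)^r * (det d_{I,J})^2;
   if the sign (+-1)^r is -1 then every principal r-minor equals its own
   opposite and vanishes, so the product is never negative.  By symmetry, the
   row bases are exactly the I of size r with det d_{I,I} <> 0, and for those
   the Smith normal form gives |coker d_{I,I}| = |det d_{I,I}|.  Finally X is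
   invertible over the field of fractions, so X d has rank r too. *)

Require Import Defs.
From HB Require Import structures.
From mathcomp Require Import all_boot all_order all_algebra finmap.
From mathcomp Require Import boolp classical_sets cardinality.
From mathcomp Require Import mpoly.

Set Implicit Arguments.
Unset Strict Implicit.
Unset Printing Implicit Defensive.

Import Order.TTheory GRing.Theory Num.Theory.
Local Open Scope ring_scope.

(** * Rank and minors over a field *)

Lemma mxrank_sub_le (F : fieldType) (m n p q : nat) (f : 'I_p -> 'I_m)
    (g : 'I_q -> 'I_n) (A : 'M[F]_(m, n)) : (\rank (mxsub f g A) <= \rank A)%N.
Proof.
rewrite -[A]mul1mx -[in mxsub _ _ _](mulmx1 (1%:M *m A)) mxsub_mul.
rewrite -mul_rowsub_mx.
apply: leq_trans (mxrankM_maxl _ _) _; rewrite mul1mx.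
exact: mxrankM_maxr.
Qed.

(** A maximal independent set of rows is chosen first, then a maximal independent set of columns
    within those rows; transposition preserves rank, so both have size [\rank A]. *)
Lemma unit_maxminor (F : fieldType) (m n : nat) (A : 'M[F]_(m, n)) :
  exists (f : 'I_(\rank A) -> 'I_m) (g : 'I_(\rank A) -> 'I_n),
    mxsub f g A \in unitmx.
Proof.
set B := rowsub (maxrankfun A) A.
have rB : \rank B^T = \rank A by rewrite mxrank_tr eq_maxrowsub.
move: (maxrankfun B^T) (maxrowsub_free B^T); rewrite rB => g freeBg.
exists (maxrankfun A), g.
suff -> : mxsub (maxrankfun A) g A = (rowsub g B^T)^T.
  by rewrite unitmx_tr -row_free_unit.
by apply/matrixP=> i j; rewrite !mxE.
Qed.

(* The rank is the size of the largest nonvanishing minor, and minors commute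
   with ring morphisms. *)
Lemma mxrank_map_inj (R : comNzRingType) (F G : fieldType)
    (phi : {rmorphism R -> F}) (psi : {rmorphism R -> G}) (m n : nat)
    (A : 'M[R]_(m, n)) :
  injective phi -> injective psi ->
  \rank (map_mx phi A) = \rank (map_mx psi A).
Proof.
have half (E E' : fieldType) (e : {rmorphism R -> E}) (e' : {rmorphism R -> E'}) :
    injective e' -> (\rank (map_mx e A) <= \rank (map_mx e' A))%N.
  move=> inj_e'; have [f [g]] := unit_maxminor (map_mx e A).
  rewrite -map_mxsub unitmxE det_map_mx unitfE => detN0.
  suff /mxrank_unit<- : mxsub f g (map_mx e' A) \in unitmx.
    exact: mxrank_sub_le.
  rewrite -map_mxsub unitmxE det_map_mx unitfE.
  by apply: contra_neq detN0; rewrite -(rmorph0 e') => /inj_e'->; rewrite rmorph0.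
by move=> inj_phi inj_psi; apply/eqP; rewrite eqn_leq !half.
Qed.

(** Both selected factors are square because the inner size is [p]. The equation [e] is explicit so
    that a rank factorization, of inner size [\rank A], fits. *)
Lemma det_mxsub_mul (R : comPzRingType) (n r p : nat) (A : 'M[R]_(n, r))
    (B : 'M[R]_(r, n)) (f g : 'I_p -> 'I_n) (e : r = p) :
  \det (mxsub f g (A *m B)) =
  \det (mxsub f (cast_ord (esym e)) A) * \det (mxsub (cast_ord (esym e)) g B).
Proof.
subst p; rewrite mxsub_mul det_mulmx.
have castK : cast_ord (esym (erefl r)) =1 id by move=> i; apply: val_inj.
by congr (_ * _); congr (\det _); apply: eq_mxsub.
Qed.

(** Transposition turns the rows chosen by [f] into a nonzero multiple of the columns chosen by [f],
    so the two selections have equal rank. Conversely, an invertible block makes the chosen rows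
    independent, and [\rank A] independent rows span. *)
Lemma row_basis_mxsub (F : fieldType) (n p : nat) (s : F) (A : 'M[F]_n)
    (f : 'I_p -> 'I_n) : s != 0 -> A^T = s *: A ->
  row_free (rowsub f A) && (rowsub f A == A)%MS =
  (p == \rank A) && (mxsub f f A \in unitmx).
Proof.
move=> s0 symA; apply/andP/andP=> [[freeA eqA]|[/eqP rA unitA]].
  have rf : \rank (rowsub f A) = p by apply/eqP.
  split; first by rewrite -(eqmxP eqA) rf.
  rewrite -row_free_unit /row_free eqn_leq rank_leq_row /=.
  case/andP: eqA => _ /submxP[C defA].
  have rcol : \rank (colsub f A) = p.
    by rewrite -mxrank_tr trmx_mxsub symA linearZ /= mxrank_scale_nz // rf.
  (* With [A] equal to [C] times its chosen rows, the chosen columns are [C] times the principal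
     block, so the block has rank at least [p]. *)
  rewrite -[leqLHS]rcol [in colsub _ _]defA -mulmx_colsub.
  apply: leq_trans (mxrankM_maxr _ _) _.
  suff -> : colsub f (rowsub f A) = mxsub f f A by [].
  by apply/matrixP=> i j; rewrite !mxE.
have freeA : row_free (rowsub f A).
  rewrite /row_free eqn_leq rank_leq_row /= -[leqLHS](mxrank_unit unitA).
  suff -> : mxsub f f A = mxsub id f (rowsub f A) by exact: mxrank_sub_le.
  by apply/matrixP=> i j; rewrite !mxE.
split=> //; have sub : (rowsub f A <= A)%MS by rewrite rowsubE submxMl.
by rewrite -(mxrank_leqif_eq sub) -rA.
Qed.

Lemma principal_minors_mul_ge0 (F : realFieldType) (n p q : nat) (s : F)
    (A : 'M[F]_n) (f : 'I_p -> 'I_n) (g : 'I_q -> 'I_n) :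
    s ^+ 2 = 1 -> A^T = s *: A -> p = \rank A -> q = \rank A ->
  0 <= \det (mxsub f f A) * \det (mxsub g g A).
Proof.
move=> s2 symA rp rq; move: f; rewrite rp -rq {rp} => f.
have minors (h k : 'I_q -> 'I_n) :
    \det (mxsub h k A) = s ^+ q * \det (mxsub k h A).
  by rewrite -det_tr trmx_mxsub symA linearZ /= detZ.
have [sq1|sqN1] : s ^+ q = 1 \/ s ^+ q = -1.
- have := sqrf_eq1 (s ^+ q); rewrite -exprM mulnC exprM s2 expr1n eqxx.
  by case/esym/orP=> /eqP; [left | right].
- have swap : \det (mxsub f f A) * \det (mxsub g g A) =
      \det (mxsub f g A) * \det (mxsub g f A).
    rewrite -[A]mulmx_base !(det_mxsub_mul _ _ _ _ (esym rq)).
    by rewrite mulrACA [in RHS]mulrACA; congr (_ * _); rewrite mulrC.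
  rewrite swap [\det (mxsub f g A)]minors sq1 mul1r -expr2.
  exact: sqr_ge0.
suff -> : \det (mxsub f f A) = 0 by rewrite mul0r.
have /eqP := minors f f; rewrite sqN1 mulN1r -subr_eq0 opprK -mulr2n.
by rewrite -mulr_natr mulf_eq0 pnatr_eq0 orbF => /eqP.
Qed.

(** * Cokernels of nonsingular integer matrices *)

Lemma card_fset_setT_bij (T : finType) (U : choiceType) (g : T -> U) :
  injective g -> (forall u, exists t, g t = u) ->
  finite_set [set: U]%classic /\ #|` fset_set [set: U]%classic|%fset = #|T|.
Proof.
move=> inj_g surj_g.
have finU : finite_set [set: U]%classic.
  apply: (@sub_finite_set _ _ (g @` [set: T])%classic).
    by move=> u _; have [t <-] := surj_g u; exists t.
  exact/finite_image/finite_finset.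
split=> //; have -> : fset_set [set: U]%classic = [fset g x | x in T]%fset.
  apply/fsetP=> u; rewrite in_fset_set // mem_set //; apply/esym/imfsetP.
  by have [t <-] := surj_g u; exists t.
by rewrite card_imfset //= cardE.
Qed.

Lemma absz_unit (u : int) : u \is a GRing.unit -> `|u|%N = 1%N.
Proof.
by move/divrr/(congr1 absz)/eqP; rewrite abszM muln_eq1 => /andP[/eqP].
Qed.

(** [L] cancels and [R] only reparametrizes the source, which leaves the image of the diagonal
    matrix, tested coordinatewise. *)
Lemma mem_im_mx_Smith (n : nat) (L R : 'M[int]_n) (e : 'rV[int]_n)
    (v : 'cV[int]_n) : L \in unitmx -> R \in unitmx ->
  (L *m v \in im_mx (L *m diag_mx e *m R)) = [forall i, (e 0%R i %| v i 0%R)%Z].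
Proof.
move=> uL uR; apply/asboolP/forallP => [[u Luv] i|ev].
  have -> : v = diag_mx e *m (R *m u).
    by rewrite -[v](mulKmx uL) Luv -!mulmxA mulKmx.
  by rewrite mul_diag_mx mxE dvdz_mulr.
exists (invmx R *m \col_i (v i 0%R %/ e 0%R i)%Z).
rewrite -!mulmxA mulKVmx //; congr (_ *m _); apply/colP=> i.
by rewrite mul_diag_mx !mxE mulrC divzK.
Qed.

(* Smith normal form reduces to a diagonal matrix with entries [e_i], whose
   cokernel is the product of the [Z / e_i]. *)
Lemma card_coker_det (n : nat) (M : 'M[int]_n) : \det M != 0 ->
  finite_set [set: coker M]%classic /\ card_coker M = `|\det M|%N.
Proof.
have [L uL [R uR [s _ defM]]] := int_Smith_normal_form M.
(* Entries beyond the end of [s] read as 0; the nonzero determinant rules them out in [e_gt0]. *)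
pose e : 'rV[int]_n := \row_i s`_i.
have {}defM : M = L *m diag_mx e *m R.
  rewrite defM; congr (_ *m _ *m _); apply/matrixP=> i j; rewrite !mxE.
  by congr (_ *+ _).
have absdetM : `|\det M|%N = (\prod_i `|e 0%R i|)%N.
  have absdet1 (U : 'M[int]_n) : U \in unitmx -> `|\det U|%N = 1%N.
    by rewrite unitmxE => /absz_unit.
  rewrite defM !det_mulmx !abszM det_diag !absdet1 // mul1n muln1.
  exact: (big_morph _ abszM).
rewrite -absz_eq0 absdetM -lt0n => detM_gt0.
have e_gt0 i : (0 < `|e 0%R i|)%N.
  by move: detM_gt0; rewrite (bigD1 i) //= muln_gt0 => /andP[].
(* A tuple of remainders modulo the [e 0 i] names one class, in the coordinates given by [L]. *)
pose T := fprod (fun i => 'I_`|e 0%R i|%N).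
pose Q := Quotient.quot (im_mx M).
pose g (x : T) : Q := \pi_Q%qT (L *m \col_i (x i : nat)%:Z).
have piE v w : (\pi_Q%qT (L *m v) == \pi_Q%qT (L *m w)) =
    [forall i, (v i 0%R == w i 0%R %[mod e 0%R i])%Z].
  rewrite -Quotient.idealrBE -mulmxBr defM mem_im_mx_Smith //.
  by apply: eq_forallb => i; rewrite eqz_mod_dvd !mxE.
have [] := @card_fset_setT_bij T (coker M) g.
- move=> x y /eqP; rewrite piE => /forallP xy; apply/fprodP => i.
  have := xy i; rewrite [X in (X %% _)%Z]mxE [X in _ == (X %% _)%Z]mxE.
  rewrite -!(modz_abs _ (e 0 i)) !modz_nat !modn_small ?ltn_ord //.
  by move=> /eqP[xyi]; apply: val_inj.
(* The preimage of [q] consists of the remainders of a representative written in these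
   coordinates. *)
- move=> q; pose w := invmx L *m repr q.
  have lt_mod i : (`|(w i 0%R %% e 0%R i)%Z| < `|e 0%R i|)%N.
    rewrite -ltz_nat gez0_abs ?modz_ge0 -?absz_gt0 //.
    by rewrite abszE ltz_mod // -absz_gt0.
  exists [fprod i => Ordinal (lt_mod i)].
  rewrite -[RHS]reprK -[repr q](mulKVmx uL) -/w; apply/eqP; rewrite piE.
  apply/forallP=> i; rewrite [X in (X %% _)%Z]mxE fprodE /=.
  by rewrite gez0_abs ?modz_ge0 -?absz_gt0 // modz_mod.
move=> finM cardM; split=> //.
rewrite /card_coker cardM card_fprod; apply: eq_bigr => i _.
by rewrite card_ord.
Qed.

(** * Effect of the diagonal factor on minors and rank *)

Lemma det_submx_set_diag (R : comPzRingType) (n : nat) (x : 'rV[R]_n)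
    (A : 'M[R]_n) (I : {set 'I_n}) :
  \det (submx_set (diag_mx x *m A) I I) =
  (\prod_(i in I) x 0 i) * \det (submx_set A I I).
Proof.
have -> : submx_set (diag_mx x *m A) I I =
    diag_mx (\row_i x 0 (enum_val i)) *m submx_set A I I.
  by apply/matrixP=> i j; rewrite !mul_diag_mx !mxE.
rewrite det_mulmx det_diag [in RHS]big_enum_val; congr (_ * _).
by apply: eq_bigr => i _; rewrite mxE.
Qed.

Lemma tofrac_inj (R : idomainType) : injective (@tofrac R).
Proof. by move=> x y /eqP; rewrite tofrac_eq => /eqP. Qed.

Lemma frac_rank_rat (m n : nat) (d : 'M[int]_(m, n)) :
  frac_rank d = \rank (map_mx intr d : 'M[rat]_(m, n)).
Proof.
by apply: mxrank_map_inj; [exact: tofrac_inj | exact: intr_inj].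
Qed.

Lemma frac_rank_diag_mpoly (n : nat) (d : 'M[int]_n) :
  frac_rank (diag_mx (\row_(i < n) 'X_i) *m map_mx (@mpolyC n int) d
              : 'M[{mpoly int[n]}]_n) = frac_rank d.
Proof.
rewrite /frac_rank map_mxM eqmxMfull.
  (* Once the diagonal factor is gone, the integers embed in two fields, one of them through
     constant polynomials, and the rank of [d] is the same in both. *)
  rewrite -map_mx_comp; apply: mxrank_map_inj; last exact: tofrac_inj.
  by move=> x y /tofrac_inj /eqP; rewrite mpolyC_eq => /eqP.
rewrite row_full_unit unitmxE det_map_mx unitfE tofrac_eq0 det_diag.
by apply/prodf_neq0 => i _; rewrite mxE -msize_poly_eq0 msizeX.
Qed.

(** * Principal minors of an integer matrix, symmetric for [s = 1] and skew-symmetric for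
    [s = -1] *)

Section SymmetricMinors.
Variables (n : nat) (d : 'M[int]_n) (s : int).
Hypotheses (s_sqr : s ^+ 2 = 1) (sym_d : d^T = s *: d).

Let dQ : 'M[rat]_n := map_mx intr d.

Let sym_dQ : dQ^T = s%:~R *: dQ.
Proof. by rewrite map_trmx sym_d map_mxZ. Qed.

Lemma in_RowB_sym (I : {set 'I_n}) :
  (I \in RowB d) = (#|I| == frac_rank d) && (\det (submx_set d I I) != 0).
Proof.
rewrite inE /= -/dQ (row_basis_mxsub _ _ sym_dQ) -?frac_rank_rat; last first.
  rewrite intr_eq0; apply: contra_eq_neq s_sqr => ->.
  by rewrite expr0n eq_sym oner_neq0.
by rewrite -map_mxsub unitmxE det_map_mx unitfE intr_eq0.
Qed.

Lemma det_submx_set_mul_ge0 (I J : {set 'I_n}) :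
    #|I| = frac_rank d -> #|J| = frac_rank d ->
  0 <= \det (submx_set d I I) * \det (submx_set d J J).
Proof.
rewrite frac_rank_rat => rI rJ.
rewrite -(ler_int rat) intrM -!det_map_mx !map_mxsub.
apply: principal_minors_mul_ge0 sym_dQ rI rJ.
by rewrite -rmorphXn s_sqr.
Qed.

(** Minors outside [RowB d] vanish. One statement serves both identities: [w] is 1 and [phi] the
    identity for [d], while [w] is the monomial and [phi] the constant embedding for the scaled
    matrix. *)
Lemma sum_minors_RowB (R : comPzRingType) (phi : {rmorphism int -> R})
    (w : {set 'I_n} -> R) :
  \sum_(I : {set 'I_n} | #|I| == frac_rank d)
    w I * phi (\det (submx_set d I I)) =
  \sum_(I in RowB d) w I * phi (\det (submx_set d I I)).
Proof.
rewrite (eq_bigl _ _ in_RowB_sym) big_mkcondr; apply: eq_bigr => I _.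
by case: eqP => //= ->; rewrite rmorph0 mulr0.
Qed.

End SymmetricMinors.

Theorem theorem4p2 (n r : nat) (d : 'M[int]_n)
    (rank_d : frac_rank d = r) (sym_d : d^T = d \/ d^T = - d) :
  exists eps : int,
    [/\ eps = 1 \/ eps = -1,
        forall I : {set 'I_n}, #|I| = r -> \det (submx_set d I I) <> 0 ->
          Num.sg (\det (submx_set d I I)) = eps,
        forall I : {set 'I_n}, I \in RowB d ->
          finite_set [set: coker (submx_set d I I)],
        pdet d = eps * \sum_(I in RowB d) (card_coker (submx_set d I I))%:Z
      & pdet (diag_mx (\row_(i < n) 'X_i) *m map_mx (@mpolyC n int) d
              : 'M[{mpoly int[n]}]_n)
        = eps%:MP * \sum_(I in RowB d)
            (\prod_(i in I) 'X_i) * (card_coker (submx_set d I I))%:R].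
Proof.
have [s s2 symd] : exists2 s : int, s ^+ 2 = 1 & d^T = s *: d.
  by case: sym_d => ->; [exists 1 | exists (-1)]; rewrite ?scale1r ?scaleN1r.
have RowBE := in_RowB_sym s2 symd.
have [eps eps1 sgE] : exists2 eps : int, eps = 1 \/ eps = -1 &
    forall I, I \in RowB d -> Num.sg (\det (submx_set d I I)) = eps.
  (* The sign is read off the minor at one row basis; with no row basis the condition would be
     vacuous and 1 would do. *)
  have [[I IB]|RowB0] := pselect (exists I, I \in RowB d); last first.
    by exists 1; [left | move=> I IB; case: RowB0; exists I].
  exists (Num.sg (\det (submx_set d I I))) => [|J].
    move: IB; rewrite RowBE => /andP[_]; rewrite -sgr_eq0.
    by case: sgrP => // _ _; [left | right].
  move: IB; rewrite !RowBE => /andP[/eqP rI I0] /andP[/eqP rJ J0].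
  (* Two nonzero minors with nonnegative product have positive product, hence equal signs. *)
  have := det_submx_set_mul_ge0 s2 symd rI rJ.
  rewrite le0r mulf_eq0 (negPf I0) (negPf J0) /= -sgr_cp0 sgrM.
  move: I0 J0; rewrite -[\det (submx_set d I I) == 0]sgr_eq0.
  rewrite -[\det (submx_set d J J) == 0]sgr_eq0.
  by case: sgrP => // _ _; case: sgrP.
have detE I : I \in RowB d -> finite_set [set: coker (submx_set d I I)]%classic
    /\ \det (submx_set d I I) = eps * (card_coker (submx_set d I I))%:Z.
  move=> IB; have := IB; rewrite RowBE => /andP[_ /card_coker_det[fin ->]].
  by split=> //; rewrite abszE -(sgE I IB) -numEsg.
exists eps; split=> //.
- by move=> I /eqP rI /eqP dI; rewrite sgE // RowBE rank_d rI.
- by move=> I /detE[].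
- have := sum_minors_RowB s2 symd idfun (fun=> 1).
  under eq_bigr do rewrite mul1r; rewrite /pdet => ->.
  by rewrite mulr_sumr; apply: eq_bigr => I /detE[_ ->]; rewrite mul1r.
rewrite /pdet frac_rank_diag_mpoly.
under eq_bigr => I _.
  rewrite det_submx_set_diag /submx_set -map_mxsub det_map_mx.
  under eq_bigr do rewrite mxE.
  over.
rewrite (sum_minors_RowB s2 symd (@mpolyC n int)
  (fun I : {set 'I_n} => \prod_(i in I) 'X_i)) mulr_sumr.
apply: eq_bigr => I /detE[_ ->].
by rewrite /= mpolyCM mulrCA -natz rmorph_nat.
Qed.
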